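(* Let $f:\mathbb{N}\times\mathbb{N}\to\mathbb{C}$ be an arithmetic function of two variables satisfying $$\sum_{q_1,q_2=1}^\infty\frac{|(f*\mathbf{1})(q_1,q_2)|}{q_1q_2}\tau(q_1)\tau(q_2)<\infty.$$ Then its dual Ramanujan-Fourier series is pointwise convergent and $f(q_1,q_2)=\sum_{n_1,n_2=1}^\infty a(n_1,n_2)c_{q_1}(n_1)c_{q_2}(n_2)$ holds for all $q_1,q_2\in\mathbb{N}$, where $$a(n_1,n_2)=\sum_{m_1,m_2=1}^\infty\frac{(f*\mathbf{1})(n_1m_1,n_2m_2)}{n_1m_1n_2m_2}\mu(m_1)\mu(m_2).$$
   Context: $\mathbb{N}=\{1,2,\dots\}$. $c_q(n)=\sum_{1\le k\le q,\,(k,q)=1}\exp(2\pi i kn/q)$ is the Ramanujan sum; $\mu$ is the Möbius function; $\tau(q)$ is the number of divisors of $q$. For a function $f$ of two variables, $(f*\mathbf{1})(q_1,q_2)=\sum_{d_1\mid q_1,\,d_2\mid q_2}f(d_1,d_2)$. Double series are understood as limits of rectangular partial sums over $n_1\le x$, $n_2\le y$ as $x,y\to\infty$. *)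

(* Defs.v *)
From HB Require Import structures.
From mathcomp Require Import all_boot all_order all_algebra.
From mathcomp Require Import complex.
From mathcomp Require Import all_classical all_reals all_analysis.

Set Implicit Arguments.
Unset Strict Implicit.
Unset Printing Implicit Defensive.

Import Order.TTheory GRing.Theory Num.Theory.
Import numFieldNormedType.Exports.

Local Open Scope classical_set_scope.
Local Open Scope ring_scope.

(* [complex R] carries no topology of its own; [R[i]^o] has the one given by
   the norm of the numFieldType [R[i]]. *)
Notation Cplx R := (R[i]^o).

(* The positive integers are represented by the nonzero elements of [nat]: all
   sums below start at 1, and functions are never evaluated at 0. *)

Definition double_psum (V : zmodType) (u : nat -> nat -> V) (xy : nat * nat) : V :=
  \sum_(1 <= n1 < xy.1.+1) \sum_(1 <= n2 < xy.2.+1) u n1 n2.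

Definition double_series_to (K : numFieldType) (V : normedModType K)
    (u : nat -> nat -> V) (l : V) : Prop :=
  double_psum u @ filter_prod \oo \oo --> l.

Definition double_series_cvg (K : numFieldType) (V : normedModType K)
    (u : nat -> nat -> V) : Prop :=
  cvg (double_psum u @ filter_prod \oo \oo).

Definition double_series_sum (K : numFieldType) (V : normedModType K)
    (u : nat -> nat -> V) : V :=
  lim (double_psum u @ filter_prod \oo \oo).

Definition cexpi (R : realType) (t : R) : R[i] := (cos t +i* sin t)%C.

Definition ramanujan_sum (R : realType) (q n : nat) : R[i] :=
  \sum_(1 <= k < q.+1 | coprime k q) cexpi (2 * pi * k%:R * n%:R / q%:R).

Definition mobius (n : nat) : int :=
  if all (fun p => logn p n == 1%N) (primes n) then (-1) ^+ size (primes n)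
  else 0.

Definition tau (n : nat) : nat := size (divisors n).

Definition conv_one (R : realType) (f : nat -> nat -> R[i]) (q1 q2 : nat) : R[i] :=
  \sum_(d1 <- divisors q1) \sum_(d2 <- divisors q2) f d1 d2.

Definition rf_coef_term (R : realType) (f : nat -> nat -> R[i])
    (n1 n2 m1 m2 : nat) : Cplx R :=
  conv_one f (n1 * m1)%N (n2 * m2)%N / (n1 * m1 * n2 * m2)%:R
  * (mobius m1)%:~R * (mobius m2)%:~R.

Definition rf_coef (R : realType) (f : nat -> nat -> R[i]) (n1 n2 : nat) : Cplx R :=
  double_series_sum (rf_coef_term f n1 n2).

(* Main.v *)
Require Import Defs.
From mathcomp Require Import all_boot all_order all_algebra.
From mathcomp Require Import complex ring lra.
From mathcomp Require Import all_classical all_reals all_analysis.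

Set Implicit Arguments.
Unset Strict Implicit.
Unset Printing Implicit Defensive.

Import Order.TTheory GRing.Theory Num.Theory.
Import numFieldNormedType.Exports.

Local Open Scope classical_set_scope.
Local Open Scope ring_scope.

(** Write F = f * 1 and G(N1,N2) = F(N1,N2) / (N1 N2).  Inserting the definition
    of a(n1,n2) and collecting the terms with n_i m_i = N_i turns the dual series
    into the sum of G(N1,N2) b1(N1) b2(N2) with b_i(N) the Dirichlet convolution
    of c_{q_i} and mu at N.  Since c_q(n) is the sum of d mu(q/d) over the common
    divisors d of n and q, Moebius inversion gives b_i(N) = N mu(q_i/N) if N | q_i
    and 0 otherwise, and the sum collapses to f(q1,q2) by a further Moebius
    inversion.  Rearrangement is justified on finite truncations: a truncated
    b_i(N) is bounded by q_i tau(N) and is exact as soon as both truncation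
    parameters are at least N, so the error is at most 2 q1 q2 times a tail of
    the convergent series in the hypothesis. *)

(** * The Möbius function *)

Lemma mobius1 : mobius 1 = 1.
Proof. by []. Qed.

Lemma mobius_primeM (p e : nat) : prime p -> (0 < e)%N -> ~~ (p %| e)%N ->
  mobius (p * e) = - mobius e.
Proof.
move=> pr_p e0 pe.
have p0 := prime_gt0 pr_p.
have pnin : p \notin primes e by rewrite mem_primes pr_p e0.
have ppe : perm_eq (primes (p * e)) (p :: primes e).
  apply: uniq_perm; rewrite ?primes_uniq//= ?pnin ?primes_uniq// => x.
  by rewrite primesM// in_cons primes_prime// inE.
rewrite /mobius (perm_size ppe) (perm_all _ ppe) /= exprS mulN1r.
have -> : logn p (p * e) = 1%N.
  by rewrite lognM// logn_prime// eqxx (eqP _ : logn p e = 0%N)// lognE pr_p e0 (negPf pe).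
rewrite eqxx /=.
have -> : all (fun q => logn q (p * e) == 1%N) (primes e) =
          all (fun q => logn q e == 1%N) (primes e).
  apply: eq_in_all => q qe; rewrite lognM// logn_prime//.
  have [qp|//] := eqVneq q p.
  by rewrite qp (negPf pnin) in qe.
by case: ifP => // _; rewrite oppr0.
Qed.

Lemma mobius_sqr_dvd (p n : nat) : prime p -> (0 < n)%N -> (p * p %| n)%N ->
  mobius n = 0.
Proof.
move=> pr_p n0 ppn; rewrite /mobius; case: ifP => // /allP/(_ p).
rewrite mem_primes pr_p n0 (dvdn_trans _ ppn) ?dvdn_mulr// => /(_ isT)/eqP l1.
by move: ppn; rewrite mulnn pfactor_dvdn// l1.
Qed.

Lemma norm_mobius_le1 (K : numDomainType) (n : nat) :
  `|(mobius n)%:~R : K| <= 1.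
Proof.
rewrite /mobius; case: ifP => _; last by rewrite normr0.
by rewrite rmorphXn/= rmorphN1 normrX normrN normr1 expr1n.
Qed.

Lemma divisors_le (n d : nat) : d \in divisors n -> (0 < n)%N ->
  (0 < d <= n)%N.
Proof. by move=> + n0; rewrite -dvdn_divisors// => dn; rewrite (dvdn_gt0 n0)// dvdn_leq. Qed.

(** * Divisor sums and Möbius inversion *)

Section DivisorSums.
Variable K : pzRingType.
Implicit Types (n d : nat) (F : nat -> K).

Lemma sum_divisorsE n m F : (0 < n)%N -> (n <= m)%N ->
  \sum_(d <- divisors n) F d = \sum_(1 <= d < m.+1 | (d %| n)%N) F d.
Proof.
move=> n0 nm; rewrite -[RHS]big_filter; apply: perm_big.
apply: uniq_perm; rewrite ?divisors_uniq ?filter_uniq ?iota_uniq// => d.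
rewrite mem_filter -dvdn_divisors// mem_index_iota.
by case: (boolP (d %| n)%N) => //= dn; rewrite (dvdn_gt0 n0 dn) ltnS (leq_trans (dvdn_leq n0 dn)).
Qed.

Lemma sum_divisors_rev n F : (0 < n)%N ->
  \sum_(d <- divisors n) F d = \sum_(d <- divisors n) F (n %/ d)%N.
Proof.
move=> n0; rewrite -[RHS](big_map (fun d => n %/ d)%N predT).
have inj : {in divisors n &, injective (fun d => n %/ d)%N}.
  move=> a b; rewrite -!dvdn_divisors// => an bn ab.
  have := divnK an; rewrite ab => e1.
  apply/eqP; rewrite -(eqn_pmul2l (_ : 0 < n %/ b)%N) ?divn_gt0 ?(dvdn_leq n0)// ?(dvdn_gt0 n0)//.
  by rewrite e1 divnK.
apply: perm_big; apply: uniq_perm; rewrite ?divisors_uniq//.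
  by rewrite map_inj_in_uniq ?divisors_uniq.
move=> d; rewrite -dvdn_divisors//; apply/idP/mapP.
  move=> dn; exists (n %/ d)%N; first by rewrite -dvdn_divisors// dvdn_div.
  by rewrite divnA// mulKn.
by move=> [x]; rewrite -dvdn_divisors// => xn ->; exact: dvdn_div.
Qed.

(** Fix a prime factor [p] of [n > 1]. Divisors divisible by [p * p] contribute 0, and the remaining
    ones cancel in pairs [e], [p * e] with [e] not divisible by [p]. *)
Lemma sum_mobius n : (0 < n)%N ->
  \sum_(d <- divisors n) (mobius d)%:~R = (n == 1%N)%:R :> K.
Proof.
move=> n0; have [->|n1] := eqVneq n 1%N; first by rewrite unlock /= addr0.
have pr_p : prime (pdiv n) by rewrite pdiv_prime// ltn_neqAle eq_sym n1.
set p := pdiv n in pr_p *; have pn : (p %| n)%N := pdiv_dvd n.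
rewrite (bigID (fun d => p %| d)%N) /= [X in X + _](bigID (fun d => p * p %| d)%N) /=.
rewrite [X in X + _ + _]big_seq_cond [X in X + _ + _]big1 ?add0r; last first.
  move=> d /and3P[]; rewrite -dvdn_divisors// => dn _ ppd.
  by rewrite (mobius_sqr_dvd pr_p)// (dvdn_gt0 n0).
have p0 := prime_gt0 pr_p.
have -> : \sum_(d <- divisors n | (p %| d)%N && ~~ (p * p %| d)%N) (mobius d)%:~R =
   \sum_(d <- divisors n | ~~ (p %| d)%N) (mobius (p * d))%:~R :> K.
  rewrite -big_filter -[RHS]big_filter -[RHS](big_map (muln p) predT (fun d => (mobius d)%:~R)).
  apply: perm_big; apply: uniq_perm; rewrite ?filter_uniq ?divisors_uniq//.
    rewrite map_inj_in_uniq ?filter_uniq ?divisors_uniq// => a b _ _ /eqP.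
    by rewrite eqn_pmul2l// => /eqP.
  move=> d; rewrite mem_filter -dvdn_divisors//; apply/idP/mapP.
    move=> /andP[/andP[/dvdnP[e ->]]]; rewrite [(e * p)%N]mulnC dvdn_pmul2l// => pe pen.
    exists e => //; rewrite mem_filter pe -dvdn_divisors//.
    exact: dvdn_trans (dvdn_mull _ _) pen.
  move=> [e]; rewrite mem_filter -dvdn_divisors// => /andP[pe en ->].
  by rewrite dvdn_mulr// dvdn_pmul2l// pe /= Gauss_dvd ?pn// prime_coprime.
rewrite -big_split /= big_seq_cond big1// => d /andP[].
rewrite -dvdn_divisors// => dn pd.
by rewrite (mobius_primeM pr_p) ?(dvdn_gt0 n0)// rmorphN addNr.
Qed.

(** After substituting [e = q / N] and exchanging the sums, the coefficient of [F d] is the sum of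
    [mobius e] over the divisors [e] of [q / d], which vanishes unless [d = q]. *)
Lemma mobius_inversion F q : (0 < q)%N ->
  \sum_(N <- divisors q) (mobius (q %/ N))%:~R * (\sum_(d <- divisors N) F d) = F q.
Proof.
move=> q0.
have -> : \sum_(N <- divisors q) (mobius (q %/ N))%:~R * (\sum_(d <- divisors N) F d)
  = \sum_(e <- divisors q) \sum_(1 <= d < q.+1 | (d * e %| q)%N) (mobius e)%:~R * F d.
  rewrite sum_divisors_rev//; rewrite !big_seq; apply: eq_bigr => e.
  rewrite -dvdn_divisors// => eq; have e0 := dvdn_gt0 q0 eq.
  rewrite (@sum_divisorsE _ q) ?leq_div//; last by rewrite divn_gt0// dvdn_leq.
  rewrite divnA// mulKn// mulr_sumr; apply: eq_bigl => d.
  by rewrite -[in RHS](divnK eq) dvdn_pmul2r.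
under eq_bigr do rewrite big_mkcond.
rewrite exchange_big /=.
(* The last index [d = q] is split off: it admits only [e = 1] and yields [F q], while every [d < q]
   contributes 0. *)
rewrite big_nat_recr//= big_nat_cond [X in X + _]big1 ?add0r.
  rewrite (bigD1_seq 1%N) ?divisor1 ?divisors_uniq//= muln1 dvdnn mobius1 mul1r.
  rewrite big_seq_cond big1 ?addr0// => e /andP[]; rewrite -dvdn_divisors// => /(dvdn_gt0 q0) e0 e1.
  by rewrite -{2}[q]muln1 dvdn_pmul2l// dvdn1 (negPf e1).
move=> d /andP[/andP[d0 dq] _].
rewrite -big_mkcond/= -big_distrl/=.
have [dvq|ndvq] := boolP (d %| q)%N; last first.
  by rewrite big1_seq ?mul0r// => e /andP[/(dvdn_trans (dvdn_mulr _ (dvdnn _)))];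
    rewrite (negPf ndvq).
suff -> : \sum_(e <- divisors q | (d * e %| q)%N) (mobius e)%:~R
   = \sum_(e <- divisors (q %/ d)) (mobius e)%:~R :> K.
  rewrite sum_mobius ?divn_gt0 ?(dvdn_leq q0)//.
  by rewrite -(eqn_pmul2r d0) divnK// mul1n gtn_eqF// mul0r.
rewrite -big_filter; apply: perm_big; apply: uniq_perm; rewrite ?filter_uniq ?divisors_uniq// => e.
rewrite mem_filter -!dvdn_divisors ?divn_gt0 ?(dvdn_leq q0)//.
rewrite -[X in _ = X](dvdn_pmul2l d0) [(d * (q %/ d))%N]mulnC divnK//.
by case: (boolP (d * e %| q)%N) => //= /(dvdn_trans (dvdn_mull _ (dvdnn _))) ->.
Qed.

End DivisorSums.

(** * Exponential sums and Ramanujan sums *)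

Section Ramanujan.
Variable R : realType.
Implicit Types (t : R) (q n d N : nat).

Lemma cexpiD t s : cexpi (t + s) = cexpi t * cexpi s.
Proof. by rewrite /cexpi cosD sinD; simpc; congr (_ +i* _)%C; ring. Qed.

Lemma cexpi0 : cexpi (0 : R) = 1.
Proof. by rewrite /cexpi cos0 sin0. Qed.

Lemma cexpiMn t k : cexpi (k%:R * t) = cexpi t ^+ k.
Proof.
elim: k => [|k IH]; first by rewrite mul0r cexpi0 expr0.
by rewrite exprS -IH -cexpiD -[k.+1]addn1 natrD mulrDl mul1r addrC.
Qed.

Lemma cexpi_2pin n : cexpi (2 * pi * n%:R : R) = 1.
Proof.
rewrite [2 * pi * _]mulrC cexpiMn mulr_natl /cexpi cos2pi sin2pi.
by rewrite -[X in X ^+ _]/(1 : R[i]) expr1n.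
Qed.

Lemma norm_cexpi t : `|cexpi t| = 1.
Proof. by rewrite normc_def /= cos2Dsin2 sqrtr1. Qed.

(** Half angles: [cos t = 1 - 2 sin(t/2)^2], and [sin (t / 2)] is positive since [t / 2] lies
    strictly between 0 and [pi]. *)
Lemma cexpi_neq1 t : 0 < t -> t < 2 * pi -> cexpi t != 1.
Proof.
move=> t0 t2; apply/negP => /eqP[ct _].
have st : 0 < sin (t / 2).
  by apply: sin_gt0_pi; rewrite divr_gt0//= ltr_pdivrMr// mulrC.
have : cos (t / 2 *+ 2) = 1 by rewrite -mulr_natr divfK.
rewrite cos_mulr2n cos2sin2; have := exprn_gt0 2 st; lra.
Qed.

(** The summands are the powers of a [d]-th root of unity [z], which equals 1 exactly when [d]
    divides [n]; otherwise [z ^+ d - 1 = 0] factors as [z - 1] times a geometric sum. *)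
Lemma sum_cexpi d n : (0 < d)%N ->
  \sum_(1 <= j < d.+1) cexpi (2 * pi * j%:R * n%:R / d%:R : R)
  = if (d %| n)%N then d%:R else 0 :> R[i].
Proof.
move=> d0; have dn0 : d%:R != 0 :> R by rewrite pnatr_eq0 -lt0n.
set z := cexpi (2 * pi * n%:R / d%:R : R).
have zE j : cexpi (2 * pi * j%:R * n%:R / d%:R : R) = z ^+ j.
  by rewrite -cexpiMn; congr cexpi; field.
under eq_bigr do rewrite zE.
case: ifP => [/dvdnP[k nE]|dn].
  have -> : z = 1.
    by rewrite /z nE natrM mulrA mulfK// cexpi_2pin.
  under eq_bigr do rewrite expr1n.
  by rewrite big_const_nat subn1 /= iter_addr addr0.
have z1 : z != 1.
  (* Replacing [n] by its nonzero remainder modulo [d] brings the angle strictly between 0 and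
     [2 * pi]. *)
  rewrite /z {1}(divn_eq n d) natrD natrM mulrDr mulrDl mulrA mulfK//.
  rewrite cexpiD cexpi_2pin mul1r cexpi_neq1//.
    by rewrite divr_gt0 ?ltr0n// !mulr_gt0 ?pi_gt0// ltr0n lt0n -/(dvdn d n) dn.
  rewrite -mulrA gtr_pMr ?mulr_gt0 ?pi_gt0//.
  by rewrite ltr_pdivrMr ?ltr0n// mul1r ltr_nat ltn_mod.
have zd : z ^+ d = 1.
  by rewrite -cexpiMn mulrC divfK// cexpi_2pin.
rewrite big_add1 /= big_mkord.
under eq_bigr do rewrite exprS.
rewrite -mulr_sumr; have := subrX1 z d; rewrite zd subrr => /esym/eqP.
by rewrite mulf_eq0 subr_eq0 (negPf z1) => /eqP ->; rewrite mulr0.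
Qed.

Lemma norm_ramanujan_sum_le q n : `|ramanujan_sum R q n| <= q%:R.
Proof.
apply: le_trans (ler_norm_sum _ _ _) _.
under eq_bigr do rewrite norm_cexpi.
rewrite big_mkcond /=.
have -> : q%:R = \sum_(1 <= k < q.+1) 1 :> R[i].
  by rewrite big_const_nat subn1 /= iter_addr addr0.
by apply: ler_sum => k _; case: ifP.
Qed.

(* Coprimality is detected by [\sum_(d %| gcd k q) mobius d], and the [k]
   divisible by [d] contribute a full exponential sum modulo [q / d]. *)
Lemma ramanujan_sumE q n : (0 < q)%N ->
  ramanujan_sum R q n =
  \sum_(d <- divisors q) (mobius (q %/ d))%:~R * (if (d %| n)%N then d%:R else 0).
Proof.
move=> q0; rewrite sum_divisors_rev//.
transitivity (\sum_(1 <= k < q.+1) \sum_(d <- divisors q | (d %| k)%N)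
   (mobius d)%:~R * cexpi (2 * pi * k%:R * n%:R / q%:R : R)).
  rewrite /ramanujan_sum big_mkcond /= !big_nat; apply: eq_bigr => k /andP[k0 kq].
  rewrite -big_distrl /=.
  have -> : \sum_(d <- divisors q | (d %| k)%N) (mobius d)%:~R
     = \sum_(d <- divisors (gcdn k q)) (mobius d)%:~R :> R[i].
    rewrite -big_filter; apply: perm_big; apply: uniq_perm;
      rewrite ?filter_uniq ?divisors_uniq// => d.
    by rewrite mem_filter -!dvdn_divisors ?gcdn_gt0 ?q0 ?orbT// dvdn_gcd.
  rewrite sum_mobius ?gcdn_gt0 ?q0 ?orbT// -/(coprime k q).
  by case: ifP => _; rewrite ?mul1r ?mul0r.
under eq_bigr do rewrite big_mkcond.
rewrite exchange_big /= !big_seq; apply: eq_bigr => d.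
rewrite -dvdn_divisors// => dq; have d0 := dvdn_gt0 q0 dq.
rewrite divnA// mulKn// -big_mkcond /= -mulr_sumr; congr (_ * _).
rewrite -sum_cexpi ?divn_gt0 ?(dvdn_leq q0)//.
rewrite -big_filter.
have -> : \sum_(1 <= j < (q %/ d).+1) cexpi (2 * pi * j%:R * n%:R / (q %/ d)%:R : R)
  = \sum_(1 <= j < (q %/ d).+1) cexpi (2 * pi * (d * j)%:R * n%:R / q%:R : R).
  apply: eq_bigr => j _; congr cexpi; rewrite -{2}(divnK dq) !natrM invfM.
  have : d%:R != 0 :> R by rewrite pnatr_eq0 -lt0n.
  have : (q %/ d)%:R != 0 :> R by rewrite pnatr_eq0 -lt0n divn_gt0 ?(dvdn_leq q0).
  by move=> qd0 dn0; field; rewrite dn0; exact: qd0.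
rewrite -[RHS](big_map (muln d) predT (fun k => cexpi (2 * pi * k%:R * n%:R / q%:R : R))).
apply: perm_big; apply: uniq_perm; rewrite ?filter_uniq ?iota_uniq//.
  rewrite map_inj_in_uniq ?iota_uniq// => a b _ _ /eqP.
  by rewrite eqn_pmul2l// => /eqP.
move=> k; rewrite mem_filter mem_index_iota; apply/idP/mapP.
  move=> /andP[/dvdnP[j ->] /andP[jd0 jq]]; exists j; last by rewrite mulnC.
  by rewrite mem_index_iota ltnS leq_divRL//; move: jq jd0; rewrite ltnS muln_gt0 => -> /andP[->].
move=> [j]; rewrite mem_index_iota ltnS leq_divRL// mulnC => /andP[j0 jq] ->.
by rewrite dvdn_mulr// ltnS jq muln_gt0 d0 j0.
Qed.

(** By [ramanujan_sumE], the Ramanujan sum at [d] is the sum over the divisors [e] of [d] of [g e],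
    where [g] is supported on the divisors of [q]; Möbius inversion recovers [g N]. *)
Lemma sum_ramanujan_mobius q N : (0 < q)%N -> (0 < N)%N ->
  \sum_(d <- divisors N) ramanujan_sum R q d * (mobius (N %/ d))%:~R
  = if (N %| q)%N then N%:R * (mobius (q %/ N))%:~R else 0.
Proof.
move=> q0 N0.
pose g d : R[i] := if (d %| q)%N then d%:R * (mobius (q %/ d))%:~R else 0.
rewrite -[RHS]/(g N) -[g N](mobius_inversion g N0) !big_seq.
apply: eq_bigr => d; rewrite -dvdn_divisors// => /(dvdn_gt0 N0) d0.
rewrite mulrC; congr (_ * _); rewrite ramanujan_sumE//.
(* Both divisor sums are put on one range, where the conditions [e %| q] and [e %| d] simply trade
   places. *)
rewrite (@sum_divisorsE _ q (d + q)) ?leq_addl// (@sum_divisorsE _ d (d + q)) ?leq_addr//.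
rewrite big_mkcond [RHS]big_mkcond; apply: eq_bigr => e _; rewrite /g.
by case: (e %| q)%N; case: (e %| d)%N; rewrite ?mulr0// mulrC.
Qed.

End Ramanujan.

(** * Collecting terms according to the products [N = n * m] *)

Section Reindexing.
Variable K : comPzRingType.
Implicit Types (n m x y M N X Y : nat).

Lemma sum_multiples (phi G : nat -> K) n M X : (0 < n)%N -> (n * M <= X)%N ->
  \sum_(1 <= m < M.+1) phi m * G (n * m)%N =
  \sum_(1 <= N < X.+1)
    (if (n %| N)%N && (N %/ n <= M)%N then phi (N %/ n)%N else 0) * G N.
Proof.
move=> n0 nMX.
transitivity (\sum_(1 <= N < X.+1 | (n %| N)%N && (N %/ n <= M)%N)
    phi (N %/ n)%N * G N); last first.
  by rewrite big_mkcond; apply: eq_bigr => N _; case: ifP => // _; rewrite mul0r.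
have -> : \sum_(1 <= m < M.+1) phi m * G (n * m)%N =
   \sum_(1 <= m < M.+1) phi (n * m %/ n)%N * G (n * m)%N.
  by apply: eq_bigr => m _; rewrite mulKn.
rewrite -[RHS]big_filter -[LHS](big_map (muln n) predT (fun N => phi (N %/ n)%N * G N)).
apply: perm_big; apply: uniq_perm; rewrite ?filter_uniq ?iota_uniq//.
  rewrite map_inj_in_uniq ?iota_uniq// => a b _ _ /eqP.
  by rewrite eqn_pmul2l// => /eqP.
move=> N; rewrite mem_filter mem_index_iota; apply/mapP/idP.
  move=> [m]; rewrite mem_index_iota ltnS => /andP[m0 mM] ->.
  rewrite dvdn_mulr// mulKn// mM /= ltnS muln_gt0 n0 m0 /=.
  by rewrite (leq_trans _ nMX)// leq_mul2l mM orbT.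
move=> /andP[/andP[/dvdnP[m ->]]]; rewrite mulnK// => mM /andP[mn0 _].
exists m; last by rewrite mulnC.
by rewrite mem_index_iota ltnS mM andbT; move: mn0; rewrite muln_gt0 => /andP[].
Qed.

(** The two cutoffs are kept apart because [x] truncates the outer dual series and [M] the inner
    series for the coefficients. *)
Definition dirichlet_trunc (phi : nat -> nat -> K) x M N : K :=
  \sum_(d <- divisors N | (d <= x)%N && (N %/ d <= M)%N) phi d (N %/ d)%N.

Lemma sum_products (phi : nat -> nat -> K) (G : nat -> K) x M X : (x * M <= X)%N ->
  \sum_(1 <= n < x.+1) \sum_(1 <= m < M.+1) phi n m * G (n * m)%N =
  \sum_(1 <= N < X.+1) dirichlet_trunc phi x M N * G N.
Proof.
move=> xMX.
transitivity (\sum_(1 <= n < x.+1) \sum_(1 <= N < X.+1)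
    (if (n %| N)%N && (N %/ n <= M)%N then phi n (N %/ n)%N else 0) * G N).
  rewrite !big_nat; apply: eq_bigr => n /andP[n0 nx]; apply: sum_multiples => //.
  by rewrite (leq_trans _ xMX)// leq_mul2r -ltnS nx orbT.
rewrite exchange_big /= !big_nat; apply: eq_bigr => N /andP[N0 _].
rewrite -big_distrl /=; congr (_ * _).
rewrite /dirichlet_trunc -big_mkcond -big_filter -[RHS]big_filter.
apply: perm_big; apply: uniq_perm; rewrite ?filter_uniq ?divisors_uniq ?iota_uniq// => d.
rewrite !mem_filter -dvdn_divisors// mem_index_iota ltnS.
case: (boolP (d %| N)%N) => [/(dvdn_gt0 N0)->|]; last by rewrite andbF.
by rewrite /= andbT andbC.
Qed.

Lemma sum_products2 (phi1 phi2 : nat -> nat -> K) (G : nat -> nat -> K) x y M1 M2 X Y :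
  (x * M1 <= X)%N -> (y * M2 <= Y)%N ->
  \sum_(1 <= n1 < x.+1) \sum_(1 <= n2 < y.+1)
    \sum_(1 <= m1 < M1.+1) \sum_(1 <= m2 < M2.+1)
       phi1 n1 m1 * phi2 n2 m2 * G (n1 * m1)%N (n2 * m2)%N =
  \sum_(1 <= N1 < X.+1) \sum_(1 <= N2 < Y.+1)
    dirichlet_trunc phi1 x M1 N1 * dirichlet_trunc phi2 y M2 N2 * G N1 N2.
Proof.
move=> xX yY.
pose H N1 := \sum_(1 <= N2 < Y.+1) dirichlet_trunc phi2 y M2 N2 * G N1 N2.
transitivity (\sum_(1 <= n1 < x.+1) \sum_(1 <= m1 < M1.+1) phi1 n1 m1 * H (n1 * m1)%N).
  apply: eq_bigr => n1 _; rewrite exchange_big /=; apply: eq_bigr => m1 _.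
  rewrite /H -(sum_products _ _ yY) mulr_sumr; apply: eq_bigr => n2 _.
  by rewrite mulr_sumr; apply: eq_bigr => m2 _; rewrite mulrA.
rewrite (sum_products _ _ xX); apply: eq_bigr => N1 _.
by rewrite mulr_sumr; apply: eq_bigr => N2 _; rewrite mulrA.
Qed.

(** A divisor of [N] and its cofactor are both at most [N], so neither cutoff removes anything. *)
Lemma dirichlet_trunc_stable (phi : nat -> nat -> K) x M N :
  (0 < N)%N -> (N <= x)%N -> (N <= M)%N ->
  dirichlet_trunc phi x M N = \sum_(d <- divisors N) phi d (N %/ d)%N.
Proof.
move=> N0 Nx NM; rewrite /dirichlet_trunc big_seq_cond [RHS]big_seq_cond.
apply: eq_bigl => d; case: (boolP (d \in divisors N)) => //= /divisors_le/(_ N0)/andP[_ dN].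
by rewrite (leq_trans dN Nx) (leq_trans (leq_div _ _) NM).
Qed.

End Reindexing.

(** * Comparing two weighted sums by a tail *)

Section Estimates.
Variable K : numDomainType.
Implicit Types (N X Y : nat).

Lemma norm_dirichlet_trunc_le (phi : nat -> nat -> K) (C : K) x M N :
  (forall n m, `|phi n m| <= C) ->
  `|dirichlet_trunc phi x M N| <= C * (tau N)%:R.
Proof.
move=> hC; have C0 : 0 <= C := le_trans (normr_ge0 _) (hC 0%N 0%N).
apply: le_trans (ler_norm_sum _ _ _) _; rewrite big_mkcond /=.
have -> : C * (tau N)%:R = \sum_(d <- divisors N) C.
  by rewrite big_const_seq count_predT iter_addr addr0 mulr_natr.
by apply: ler_sum => d _; case: ifP.
Qed.

Lemma tau_gt0 N : (0 < tau N)%N.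
Proof. by rewrite /tau; case: (divisors N) (divisor1 N). Qed.

Lemma double_psum_widen (V : zmodType) (u : nat -> nat -> V) N X Y :
  (N <= X)%N -> (N <= Y)%N ->
  double_psum u (N, N) = \sum_(1 <= n1 < X.+1) \sum_(1 <= n2 < Y.+1)
     if (n1 <= N)%N && (n2 <= N)%N then u n1 n2 else 0.
Proof.
move=> NX NY; rewrite /double_psum /= (big_nat_widen _ _ X.+1)//= big_mkcond.
apply: eq_bigr => n1 _; rewrite ltnS; case: ifP => n1N /=; last by rewrite big1.
by rewrite (big_nat_widen _ _ Y.+1)//= big_mkcond; apply: eq_bigr.
Qed.

Definition tau_weight (G : nat -> nat -> K) (N1 N2 : nat) : K :=
  `|G N1 N2| * (tau N1)%:R * (tau N2)%:R.

(** The terms with both indices at most [N] cancel. Each other term is bounded by the triangle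
    inequality, and the two products of coefficients give the factor 2. *)
Lemma norm_sum_coef_diff_le (G : nat -> nat -> K) (c1 c2 b1 b2 : nat -> K) (C1 C2 : K) N X Y :
  (forall n, (0 < n)%N -> `|c1 n| <= C1 * (tau n)%:R) ->
  (forall n, (0 < n)%N -> `|c2 n| <= C2 * (tau n)%:R) ->
  (forall n, (0 < n)%N -> `|b1 n| <= C1 * (tau n)%:R) ->
  (forall n, (0 < n)%N -> `|b2 n| <= C2 * (tau n)%:R) ->
  (forall n, (0 < n <= N)%N -> c1 n = b1 n) ->
  (forall n, (0 < n <= N)%N -> c2 n = b2 n) ->
  (N <= X)%N -> (N <= Y)%N ->
  `|\sum_(1 <= N1 < X.+1) \sum_(1 <= N2 < Y.+1) c1 N1 * c2 N2 * G N1 N2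
    - \sum_(1 <= N1 < X.+1) \sum_(1 <= N2 < Y.+1) b1 N1 * b2 N2 * G N1 N2|
  <= 2 * C1 * C2 * (double_psum (tau_weight G) (X, Y) - double_psum (tau_weight G) (N, N)).
Proof.
move=> hc1 hc2 hb1 hb2 e1 e2 NX NY.
rewrite (double_psum_widen _ NX NY) /double_psum /= -!sumrB mulr_sumr.
apply: le_trans (ler_norm_sum _ _ _) _.
rewrite !big_nat; apply: ler_sum => n1 /andP[n10 _].
rewrite -!sumrB mulr_sumr; apply: le_trans (ler_norm_sum _ _ _) _.
rewrite !big_nat; apply: ler_sum => n2 /andP[n20 _].
case: ifP => [/andP[n1N n2N]|_].
  by rewrite e1 ?n10// e2 ?n20// !subrr normr0 mulr0.
rewrite subr0 -mulrBl normrM /tau_weight.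
have -> : 2 * C1 * C2 * (`|G n1 n2| * (tau n1)%:R * (tau n2)%:R) =
   (C1 * (tau n1)%:R * (C2 * (tau n2)%:R) + C1 * (tau n1)%:R * (C2 * (tau n2)%:R)) * `|G n1 n2|.
  by ring.
apply: ler_wpM2r => //; apply: le_trans (ler_normB _ _) _.
by rewrite !normrM lerD// ler_pM ?normr_ge0// ?hc1 ?hc2 ?hb1 ?hb2.
Qed.

End Estimates.

(** * Limits of rectangular partial sums, real and complex *)

Lemma near_filter_prod_ooP (P : nat * nat -> Prop) :
  (\forall xy \near filter_prod \oo \oo, P xy) <->
  exists N, forall x y, (N <= x)%N -> (N <= y)%N -> P (x, y).
Proof.
split.
  move=> [[A B] [[N1 _ AN] [N2 _ BN]] AB]; exists (maxn N1 N2) => x y.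
  rewrite !geq_max => /andP[x1 _] /andP[_ y2].
  by apply: (AB (x, y)); split; [exact: AN | exact: BN].
move=> [N hN]; exists ([set n | (N <= n)%N], [set n | (N <= n)%N]).
  by split; exists N.
by move=> [x y] [/= Nx Ny]; exact: hN.
Qed.

Section ComplexLimits.
Variable R : realType.

Lemma real_cauchy_prod_cvg (u : nat * nat -> R) :
  (forall e : R, 0 < e -> exists N, forall x y, (N <= x)%N -> (N <= y)%N ->
     `|u (N, N) - u (x, y)| <= e) ->
  cvg (u @ filter_prod \oo \oo).
Proof.
move=> hu; apply: cauchy_cvg; apply: cauchy_exP => e e0.
have [N hN] := hu (e / 2) (divr_gt0 e0 (ltr0Sn _ _)).
exists (u (N, N)); apply/near_filter_prod_ooP; exists N => x y Nx Ny /=.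
rewrite /ball /=; apply: le_lt_trans (hN _ _ Nx Ny) _.
by rewrite ltr_pdivrMr// mulr_natr mulr2n ltrDl.
Qed.

Lemma gt0_complexP (e : R[i]) : 0 < e -> exists2 r : R, 0 < r & e = r%:C%C.
Proof.
by case: e => a b; rewrite ltcE /= => /andP[/eqP -> a0]; exists a.
Qed.

Lemma norm_complex_leD (z : R[i]) :
  `|z| <= (`|complex.Re z| + `|complex.Im z|)%:C%C.
Proof.
rewrite normc_def lecR -[leRHS]ger0_norm ?addr_ge0// -sqrtr_sqr ler_wsqrtr//.
rewrite sqrrD !real_normK ?num_real// -addrA lerD2l lerDr.
by rewrite mulrn_wge0// mulr_ge0.
Qed.

(** Completeness is inherited from [R]: real and imaginary parts satisfy the same Cauchy estimate,
    and their limits are recombined. *)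
Lemma complex_cauchy_prod_cvg (u : nat * nat -> Cplx R) :
  (forall e : R, 0 < e -> exists N, forall x y, (N <= x)%N -> (N <= y)%N ->
     `|u (N, N) - u (x, y)| <= e%:C%C) ->
  cvg (u @ filter_prod \oo \oo).
Proof.
move=> hu.
have normRe (z : R[i]) (e : R) : `|z| <= e%:C%C -> `|complex.Re z| <= e.
  by move=> /(le_trans (normc_ge_Re z)); rewrite lecR.
have normIm (z : R[i]) (e : R) : `|z| <= e%:C%C -> `|complex.Im z| <= e.
  (* Multiplication by ['i] preserves the norm and turns the imaginary part into a real part, up to
     sign. *)
  move=> ze; have := normRe (z * 'i%C) e.
  by rewrite ReiNIm normrN; apply; rewrite normrM
     (_ : `|'i%C| = 1) ?mulr1// normc_def /= expr0n /= add0r expr1n sqrtr1.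
have cRe : cvg ((fun xy => complex.Re (u xy)) @ filter_prod \oo \oo).
  apply: real_cauchy_prod_cvg => e /hu[N hN]; exists N => x y Nx Ny /=.
  by have := normRe _ _ (hN _ _ Nx Ny); case: (u (N, N)) (u (x, y)) => ? ? [? ?].
have cIm : cvg ((fun xy => complex.Im (u xy)) @ filter_prod \oo \oo).
  apply: real_cauchy_prod_cvg => e /hu[N hN]; exists N => x y Nx Ny /=.
  by have := normIm _ _ (hN _ _ Nx Ny); case: (u (N, N)) (u (x, y)) => ? ? [? ?].
set a := lim _ in cRe; set b := lim _ in cIm.
apply/cvg_ex; exists (a +i* b)%C; apply/cvgrPdist_le => e /gt0_complexP[r r0 ->].
have r20 : 0 < r / 2 by rewrite divr_gt0.
move/cvgrPdist_le : cRe => /(_ _ r20) cRe.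
move/cvgrPdist_le : cIm => /(_ _ r20) cIm.
near=> xy; apply: le_trans (norm_complex_leD _) _.
rewrite lecR [leRHS]splitr lerD//.
- have : `|a - complex.Re (u xy)| <= r / 2 by near: xy.
  by case: (u xy).
- have : `|b - complex.Im (u xy)| <= r / 2 by near: xy.
  by case: (u xy).
Unshelve. all: by end_near.
Qed.

End ComplexLimits.

(** * Convergence of the coefficients and of the dual series *)

Section DualSeries.
Variables (R : realType) (f : nat -> nat -> R[i]).
Hypothesis hf : double_series_cvg (fun q1 q2 : nat =>
  ComplexField.Normc.normc (conv_one f q1 q2) / (q1 * q2)%:R
    * (tau q1)%:R * (tau q2)%:R).

Let G (N1 N2 : nat) : R[i] := conv_one f N1 N2 / (N1 * N2)%:R.
Let W : nat * nat -> R[i] := double_psum (tau_weight G).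

(** Both partial sums lie within [e / 2] of the limit in the hypothesis; [WE] carries this real
    series over to the complex-valued [W]. *)
Lemma tau_weight_tail (e : R) : 0 < e ->
  exists N, forall X Y, (N <= X)%N -> (N <= Y)%N -> W (X, Y) - W (N, N) <= e%:C%C.
Proof.
move=> e0; have e20 : 0 < e / 2 by rewrite divr_gt0.
move: hf; rewrite /double_series_cvg; set w := fun q1 q2 : nat => _ => cw.
have WE xy : W xy = (double_psum w xy)%:C%C.
  rewrite /W /double_psum rmorph_sum; apply: eq_bigr => n1 _.
  rewrite rmorph_sum; apply: eq_bigr => n2 _.
  rewrite /tau_weight /G normf_div normr_nat /w !rmorphM /= fmorphV.
  by rewrite !rmorphM /= !rmorph_nat.
move: cw => /cvg_ex[l /cvgrPdist_le/(_ _ e20)/near_filter_prod_ooP[N hN]].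
exists N => X Y NX NY; rewrite !WE -rmorphB /= lecR.
have := hN _ _ NX NY; have := hN _ _ (leqnn N) (leqnn N).
rewrite !ler_norml; lra.
Qed.

Let coefw (n M N : nat) : R[i] :=
  if (n %| N)%N && (N %/ n <= M)%N then (mobius (N %/ n))%:~R else 0.

(** The bounds [X] and [Y] are left free so that partial sums with different cutoffs can be compared
    on one rectangle. *)
Lemma double_psum_rf_coef_term n1 n2 M1 M2 X Y :
  (0 < n1)%N -> (0 < n2)%N -> (n1 * M1 <= X)%N -> (n2 * M2 <= Y)%N ->
  double_psum (rf_coef_term f n1 n2) (M1, M2) =
  \sum_(1 <= N1 < X.+1) \sum_(1 <= N2 < Y.+1) coefw n1 M1 N1 * coefw n2 M2 N2 * G N1 N2.
Proof.
move=> n10 n20 hX hY; rewrite /double_psum /=.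
transitivity (\sum_(1 <= m1 < M1.+1) (mobius m1)%:~R *
   \sum_(1 <= N2 < Y.+1) coefw n2 M2 N2 * G (n1 * m1)%N N2).
  apply: eq_bigr => m1 _.
  rewrite -(sum_multiples (fun m => (mobius m)%:~R) (G (n1 * m1)%N) n20 hY) mulr_sumr.
  apply: eq_bigr => m2 _; rewrite /rf_coef_term /G -mulnA.
  by rewrite -[LHS]mulrA mulrC -mulrA.
rewrite (sum_multiples (fun m => (mobius m)%:~R)
  (fun N1 => \sum_(1 <= N2 < Y.+1) coefw n2 M2 N2 * G N1 N2) n10 hX).
apply: eq_bigr => N1 _; rewrite mulr_sumr.
by apply: eq_bigr => N2 _; rewrite mulrA.
Qed.

(** The weights [coefw] are bounded by 1, hence by [tau], and at indices up to [N] they no longer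
    change once the cutoff reaches [N]. The partial sums are therefore Cauchy, with error at most
    twice a tail. *)
Lemma rf_coef_term_cvg n1 n2 : (0 < n1)%N -> (0 < n2)%N ->
  double_series_cvg (rf_coef_term f n1 n2).
Proof.
move=> n10 n20; apply: complex_cauchy_prod_cvg => e e0.
have [N hN] := tau_weight_tail (divr_gt0 e0 (ltr0Sn _ 1)).
exists N => x y Nx Ny.
have hb n M k : (0 < k)%N -> `|coefw n M k| <= 1 * (tau k)%:R.
  move=> _; rewrite mul1r; apply: (@le_trans _ _ 1); last by rewrite ler1n tau_gt0.
  by rewrite /coefw; case: ifP => _; rewrite ?norm_mobius_le1 ?normr0.
have hs n M k : (N <= M)%N -> (0 < k <= N)%N -> coefw n M k = coefw n N k.
  move=> NM /andP[k0 kN]; rewrite /coefw.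
  have kn : (k %/ n <= N)%N by rewrite (leq_trans (leq_div _ _)).
  by rewrite kn (leq_trans kn NM).
have nX n z : (0 < n)%N -> (N <= z)%N -> (N <= n * z)%N.
  by move=> n0 Nz; rewrite (leq_trans Nz)// leq_pmull.
rewrite (@double_psum_rf_coef_term _ _ x y (n1 * x) (n2 * y))//.
rewrite (@double_psum_rf_coef_term _ _ N N (n1 * x) (n2 * y)) ?leq_mul2l ?Nx ?Ny ?orbT//.
rewrite distrC.
apply: le_trans (norm_sum_coef_diff_le G (hb n1 x) (hb n2 y) (hb n1 N) (hb n2 N)
  (hs n1 x ^~ Nx) (hs n2 y ^~ Ny) (nX _ _ n10 Nx) (nX _ _ n20 Ny)) _.
rewrite !mulr1; apply: le_trans (ler_wpM2l _ (hN _ _ (nX _ _ n10 Nx) (nX _ _ n20 Ny))) _ => //.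
by rewrite -(rmorph_nat (real_complex R)) -rmorphM lecR mulrC divfK.
Qed.

Let phi (q n m : nat) : R[i] := ramanujan_sum R q n * (mobius m)%:~R.

(** A cutoff at [N] itself leaves the full convolution, evaluated by [sum_ramanujan_mobius]. Its
    factors [N1] and [N2] cancel the denominator of [G], and Möbius inversion in each variable
    remains. *)
Lemma sum_dirichlet_limit q1 q2 X Y : (0 < q1 <= X)%N -> (0 < q2 <= Y)%N ->
  \sum_(1 <= N1 < X.+1) \sum_(1 <= N2 < Y.+1)
    dirichlet_trunc (phi q1) N1 N1 N1 * dirichlet_trunc (phi q2) N2 N2 N2 * G N1 N2
  = f q1 q2.
Proof.
move=> /andP[q10 q1X] /andP[q20 q2Y].
rewrite -[RHS](mobius_inversion (f^~ q2) q10) (sum_divisorsE _ q10 q1X) [RHS]big_mkcond.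
rewrite !big_nat; apply: eq_bigr => N1 /andP[N10 _].
have tE q N : (0 < q)%N -> (0 < N)%N -> dirichlet_trunc (phi q) N N N =
    if (N %| q)%N then N%:R * (mobius (q %/ N))%:~R else 0.
  by move=> q0 N0; rewrite dirichlet_trunc_stable// -sum_ramanujan_mobius.
rewrite tE//; case: ifP => _; last by rewrite big1// => N2 _; rewrite !mul0r.
transitivity ((mobius (q1 %/ N1))%:~R * \sum_(N2 <- divisors q2)
   (mobius (q2 %/ N2))%:~R * \sum_(d2 <- divisors N2) \sum_(d1 <- divisors N1) f d1 d2); last first.
  by rewrite (mobius_inversion (fun d2 => \sum_(d1 <- divisors N1) f d1 d2) q20).
rewrite (sum_divisorsE _ q20 q2Y) mulr_sumr [RHS]big_mkcond.
rewrite !big_nat; apply: eq_bigr => N2 /andP[N20 _].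
rewrite tE//; case: ifP => _; last by rewrite !mulr0 mul0r.
rewrite /G /conv_one exchange_big /= natrM.
have n1 : N1%:R != 0 :> R[i] by rewrite pnatr_eq0 -lt0n.
have n2 : N2%:R != 0 :> R[i] by rewrite pnatr_eq0 -lt0n.
by field; apply/andP; split.
Qed.

(* Before passing to the limit in the inner series, the truncated sum differs
   from [f q1 q2] only in terms with some [n_i m_i > N], uniformly in [x, y]. *)
Lemma truncated_dual_series_le q1 q2 N x y M1 M2 (e : R) :
  (0 < q1)%N -> (0 < q2)%N ->
  (forall X Y, (N <= X)%N -> (N <= Y)%N -> W (X, Y) - W (N, N) <= e%:C%C) ->
  (N <= x)%N -> (N <= y)%N -> (N <= M1)%N -> (N <= M2)%N ->
  `|f q1 q2 - \sum_(1 <= n1 < x.+1) \sum_(1 <= n2 < y.+1)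
     double_psum (rf_coef_term f n1 n2) (M1, M2) *
     ramanujan_sum R q1 n1 * ramanujan_sum R q2 n2|
  <= 2 * q1%:R * q2%:R * e%:C%C.
Proof.
move=> q10 q20 hN Nx Ny NM1 NM2.
(* The rectangle must contain all products [n * m], all divisors of [q1] and [q2], and the square of
   side [N]. *)
have ub a b c : exists X, [/\ a <= X, b <= X & c <= X]%N.
  by exists (a + b + c)%N; rewrite leq_addl addnAC leq_addl -addnA leq_addr.
have [X [xX q1X NX]] := ub (x * M1)%N q1 N.
have [Y [yY q2Y NY]] := ub (y * M2)%N q2 N.
have -> : \sum_(1 <= n1 < x.+1) \sum_(1 <= n2 < y.+1)
     double_psum (rf_coef_term f n1 n2) (M1, M2) *
     ramanujan_sum R q1 n1 * ramanujan_sum R q2 n2 =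
   \sum_(1 <= n1 < x.+1) \sum_(1 <= n2 < y.+1)
    \sum_(1 <= m1 < M1.+1) \sum_(1 <= m2 < M2.+1)
       phi q1 n1 m1 * phi q2 n2 m2 * G (n1 * m1)%N (n2 * m2)%N.
  apply: eq_bigr => n1 _; apply: eq_bigr => n2 _.
  rewrite /double_psum /= !mulr_suml; apply: eq_bigr => m1 _.
  rewrite !mulr_suml; apply: eq_bigr => m2 _.
  by rewrite /rf_coef_term /phi /G mulnA; ring.
rewrite (sum_products2 _ _ _ xX yY) -(@sum_dirichlet_limit q1 q2 X Y) ?q10 ?q20//.
have hphi q n m : `|phi q n m| <= q%:R.
  rewrite normrM -[leRHS]mulr1 ler_pM// ?norm_ramanujan_sum_le//.
  exact: norm_mobius_le1.
have hb q z M n : (0 < n)%N -> `|dirichlet_trunc (phi q) z M n| <= q%:R * (tau n)%:R.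
  by move=> _; exact: norm_dirichlet_trunc_le.
have hs q z M n : (N <= z)%N -> (N <= M)%N -> (0 < n <= N)%N ->
    dirichlet_trunc (phi q) n n n = dirichlet_trunc (phi q) z M n.
  move=> Nz NM /andP[n0 nN].
  by rewrite !dirichlet_trunc_stable// (leq_trans nN).
apply: le_trans (@norm_sum_coef_diff_le _ G _ _ _ _ q1%:R q2%:R N X Y _ _ _ _ _ _ _ _) _.
- by move=> n; exact: hb.
- by move=> n; exact: hb.
- by move=> n; exact: hb.
- by move=> n; exact: hb.
- by move=> n; exact: hs.
- by move=> n; exact: hs.
- exact: NX.
- exact: NY.
by apply: ler_wpM2l; rewrite ?mulr_ge0 ?ler0n// hN.
Qed.

(** For fixed [x] and [y] only finitely many inner series occur, so they can be truncated together
    at a cost of [r / 2]. The inner cutoff may depend on [x] and [y], since the bound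
    [truncated_dual_series_le] is uniform in it. *)
Lemma dual_series_to q1 q2 : (0 < q1)%N -> (0 < q2)%N ->
  double_series_to (fun n1 n2 : nat =>
    rf_coef f n1 n2 * ramanujan_sum R q1 n1 * ramanujan_sum R q2 n2 : Cplx R)
    (f q1 q2).
Proof.
move=> q10 q20; apply/cvgrPdist_le => e /gt0_complexP[r r0 ->].
have r20 : 0 < r / 2 by rewrite divr_gt0.
(* Multiplied by the factor [2 * q1 * q2] of the truncation bound, this tail size gives [r / 2]. *)
have s0 : 0 < r / 2 / (2 * q1%:R * q2%:R) by rewrite divr_gt0// !mulr_gt0// ltr0n.
have [N hN] := tau_weight_tail s0.
apply/near_filter_prod_ooP; exists N => x y Nx Ny.
pose S (M : nat * nat) : Cplx R := \sum_(1 <= n1 < x.+1) \sum_(1 <= n2 < y.+1)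
     double_psum (rf_coef_term f n1 n2) M *
     ramanujan_sum R q1 n1 * ramanujan_sum R q2 n2.
have cS : S @ filter_prod \oo \oo --> (double_psum (fun n1 n2 : nat =>
    rf_coef f n1 n2 * ramanujan_sum R q1 n1 * ramanujan_sum R q2 n2 : Cplx R) (x, y)).
  (* The range is repeated as a guard so that [cvg_big] provides the positivity of [n1] and [n2]
     that [rf_coef_term_cvg] requires. *)
  have -> : S = fun M => \sum_(1 <= n1 < x.+1 | (1 <= n1 < x.+1)%N)
      \sum_(1 <= n2 < y.+1 | (1 <= n2 < y.+1)%N)
        double_psum (rf_coef_term f n1 n2) M *
        ramanujan_sum R q1 n1 * ramanujan_sum R q2 n2.
    by apply/funext => M; rewrite /S big_nat; apply: eq_bigr => n1 _; rewrite big_nat.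
  rewrite /double_psum big_nat /=.
  apply: (cvg_big (op := +%R)); first exact: add_continuous.
  move=> n1 /andP[n10 _]; rewrite big_nat.
  apply: (cvg_big (op := +%R)); first exact: add_continuous.
  move=> n2 /andP[n20 _].
  apply: cvgM; last exact: cvg_cst.
  apply: cvgM; last exact: cvg_cst.
  exact: rf_coef_term_cvg.
have r20C : 0 < (r / 2)%:C%C by rewrite ltcR.
move/cvgrPdist_le : cS => /(_ _ r20C) /near_filter_prod_ooP[N' hN'].
(* The inner cutoff [maxn N N'] serves both halves: closeness to the inner limits and the truncation
   bound. *)
have h1 := hN' _ _ (leq_maxr N N') (leq_maxr N N').
have h2 := truncated_dual_series_le q10 q20 hN Nx Ny (leq_maxl N N') (leq_maxl N N').
rewrite -[X in `|X|](subrKA (S (maxn N N', maxn N N'))).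
apply: le_trans (ler_normD _ _) _.
rewrite [r]splitr rmorphD lerD//.
  apply: le_trans h2 _.
  have -> : 2 * q1%:R * q2%:R = (2 * q1%:R * q2%:R : R)%:C%C.
    by rewrite !rmorphM /= !rmorph_nat.
  by rewrite -rmorphM lecR mulrC divfK// gt_eqF// !mulr_gt0// ltr0n.
by rewrite distrC.
Qed.

End DualSeries.

Theorem theorem4p4 (R : realType) (f : nat -> nat -> R[i])
    (hf : double_series_cvg (fun q1 q2 : nat =>
       ComplexField.Normc.normc (conv_one f q1 q2) / (q1 * q2)%:R
         * (tau q1)%:R * (tau q2)%:R)) :
  (forall n1 n2 : nat, (0 < n1)%N -> (0 < n2)%N ->
     double_series_cvg (rf_coef_term f n1 n2)) /\
  (forall q1 q2 : nat, (0 < q1)%N -> (0 < q2)%N ->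
     double_series_to (fun n1 n2 : nat =>
       rf_coef f n1 n2 * ramanujan_sum R q1 n1 * ramanujan_sum R q2 n2 : Cplx R)
       (f q1 q2)).
Proof.
by split=> *; [exact: rf_coef_term_cvg | exact: dual_series_to].
Qed.
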